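(* Let $\Gamma(u)=\sum_{n=1}^N\alpha_n\Gamma^{(n)}(u)$ be the operator on $B=C(\mathbb{R}_+)$ defined in the context, with symmetric kernels $A_n$, $n=2,\dots,N$. Then $\Gamma$ maps the closed unit ball $U$ of $B$ into itself, and it satisfies the $L$-Lipschitz condition $$|\Gamma(u_1)-\Gamma(u_2)|\le L(|u_1-u_2|)\qquad\text{pointwise on }\mathbb{R}_+,\ \text{for all }u_1,u_2\in U,$$ where $L:B\to B$ is the bounded linear operator $$Lu(x)=\int_0^\infty da\,K(a)\,u(ax),\qquad K(a)=\sum_{n=1}^N n\,\alpha_n K_n(a),$$ $$K_n(a)=\int_0^\infty da_2\cdots\int_0^\infty da_n\,A_n(a,a_2,\dots,a_n)$$ (so $K_1=A_1$, and $K_n$ is the first marginal of $A_n$).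
   Context: $\mathbb{R}_+=[0,\infty)$. $B=C(\mathbb{R}_+)$ is the Banach space of bounded continuous real-valued functions on $\mathbb{R}_+$ with norm $\|u\|=\sup_{x\ge0}|u(x)|$, and $U=\{u\in B:\|u\|\le1\}$. Let $N\ge1$, $\alpha_n\ge0$ $(1\le n\le N)$, $\sum_{n=1}^N\alpha_n=1$. For each $n$, $A_n(a_1,\dots,a_n)\ge0$ is a generalized density of a probability measure on $\mathbb{R}_+^n$ (i.e. $A_n(a_1,\dots,a_n)\,da_1\cdots da_n$ denotes a Borel probability measure) with compact support, symmetric under permutations of $(a_1,\dots,a_n)$. Define $$\Gamma(u)=\sum_{n=1}^N\alpha_n\Gamma^{(n)}(u),\qquad \Gamma^{(n)}(u)(x)=\int_0^\infty da_1\cdots\int_0^\infty da_n\,A_n(a_1,\dots,a_n)\prod_{k=1}^n u(a_kx),\quad x\ge0.$$ *)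

(* Defs.v *)
From HB Require Import structures.
From mathcomp Require Import all_boot all_order all_algebra perm.
From mathcomp Require Import all_classical all_reals all_analysis.
From mathcomp Require Import measurable_realfun.
Set Implicit Arguments.
Unset Strict Implicit.
Unset Printing Implicit Defensive.
Import Order.TTheory GRing.Theory Num.Theory.
Import numFieldNormedType.Exports.
Local Open Scope classical_set_scope.
Local Open Scope ring_scope.

(** Functions on R_+ are represented by functions R -> R of which only the
    restriction to [0, +oo[ matters: continuity is relative to [0, +oo[, and
    bounds, norms, integrals and pointwise relations only involve points
    of [0, +oo[. *)
Notation Rplus R := (`[0, +oo[%classic : set R).

Section BoundedContinuous.
Context (R : realType).
Implicit Types u : R -> R.

Definition Cb u : Prop :=
  {within Rplus R, continuous u} /\ [bounded u x | x in Rplus R].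

(** Meaningful only for [u] in [Cb]: [sup] is [0] on unbounded sets. *)
Definition Cb_norm u : R := sup [set `|u x| | x in Rplus R].

Definition Cb_unit_ball u : Prop := Cb u /\ Cb_norm u <= 1.

Definition Cb_bounded_linear (T : (R -> R) -> (R -> R)) : Prop :=
  [/\ forall u, Cb u -> Cb (T u),
      forall (c : R) u v, Cb u -> Cb v -> forall x, 0 <= x ->
        T (fun y => c * u y + v y) x = c * T u x + T v x &
      exists2 M : R, 0 <= M & forall u, Cb u -> Cb_norm (T u) <= M * Cb_norm u].

End BoundedContinuous.

Notation borelRn R n := (g_sigma_algebraType (@open 'rV[R]_n)).

Section MeasuresOnOrthant.
Context (R : realType) (n : nat).

Definition orthant : set (borelRn R n) :=
  [set a : 'rV[R]_n | forall k, 0 <= a ord0 k].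

Definition compactly_supported_in_orthant (mu : probability (borelRn R n) R) :
    Prop :=
  exists C : set 'rV[R]_n, [/\ compact C, C `<=` orthant & mu (~` C) = 0%E].

Definition symmetric_measure (mu : probability (borelRn R n) R) : Prop :=
  forall (s : 'S_n) (X : set (borelRn R n)), measurable X ->
    mu [set a : 'rV[R]_n | X (col_perm s a)] = mu X.

End MeasuresOnOrthant.

Section Marginal.
Context (R : realType) (n : nat).

Definition first_coord (a : borelRn R n.+1) : R := (a : 'rV[R]_n.+1) ord0 ord0.

Lemma measurable_first_coord : measurable_fun setT first_coord.
Proof.
apply: (measurability _ (RGenOpens.measurableE R)) => _ [_ [a [b ->] <-]].
rewrite setTI; apply: sub_sigma_algebra.
have /continuousP := @coord_continuous R 1 n.+1 ord0 ord0.
by apply; exact: interval_open.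
Qed.

HB.instance Definition _ :=
  isMeasurableFun.Build _ _ _ _ first_coord measurable_first_coord.

(** Integrating the generalized density of [mu] over all the variables but
    the first amounts to taking the law of the first coordinate. *)
Definition first_marginal (mu : probability (borelRn R n.+1) R) :
  probability R R := distribution mu first_coord.

End Marginal.

(** The index [i : 'I_N] stands for [n = i + 1], so that [n] ranges over
    [1, ..., N]. *)
Section Operators.
Context (R : realType) (N : nat).
Variables (alpha : 'I_N -> {nonneg R}).
Variables (A : forall i : 'I_N, probability (borelRn R i.+1) R).

Definition Gamma_ (i : 'I_N) (u : R -> R) (x : R) : R :=
  \int[A i]_(a in @orthant R i.+1)
    \prod_(k < i.+1) u ((a : 'rV[R]_i.+1) ord0 k * x).

Definition Gamma (u : R -> R) (x : R) : R :=
  \sum_(i < N) (alpha i)%:num * Gamma_ i u x.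

Local Open Scope ereal_scope.

(** The measure with generalized density [K]. *)
Definition K (X : set R) : \bar R :=
  \sum_(i < N) mscale (i.+1%:R * (alpha i)%:num)%:nng%R (first_marginal (A i)) X.

Let K0 : K set0 = 0. Proof. by rewrite /K big1. Qed.

Let K_ge0 X : 0 <= K X. Proof. by rewrite /K; apply: sume_ge0. Qed.

Let K_semi_sigma_additive : semi_sigma_additive K.
Proof.
move=> F mF tF mUF; rewrite [X in _ --> X](_ : _ =
    lim ((fun n => (\sum_(0 <= i < n) K (F i))%E) @ \oo)).
  by apply: is_cvg_ereal_nneg_natsum => k _; exact: K_ge0.
rewrite nneseries_sum//; apply: eq_bigr => /= i _.
exact: measure_semi_bigcup.
Qed.

HB.instance Definition _ := isMeasure.Build _ _ _ K
  K0 K_ge0 K_semi_sigma_additive.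

Local Close Scope ereal_scope.

Definition L (u : R -> R) (x : R) : R :=
  \int[K]_(a in Rplus R) u (a * x).

End Operators.

(* Main.v *)
(** For [|a_k|, |b_k| <= 1], telescoping gives
    [|a_1 ... a_n - b_1 ... b_n| <= \sum_k |a_k - b_k|].  Taking for the factors the
    values of [u1] and [u2] at the points [t_k x] and integrating [t] against [A_n],
    every term of the sum has the same integral, because the symmetry of [A_n]
    makes the laws of all the coordinates equal to the first marginal [K_n]:
    this is where the factor [n] in [K = \sum_n n alpha_n K_n] comes from.
    Continuity of [Gamma u] and [L u] follows from dominated convergence. *)
Require Import Defs.
From HB Require Import structures.
From mathcomp Require Import all_boot all_order all_algebra perm.
From mathcomp Require Import all_classical all_reals all_analysis.
From mathcomp Require Import measurable_realfun.
Set Implicit Arguments.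
Unset Strict Implicit.
Unset Printing Implicit Defensive.
Import Order.TTheory GRing.Theory Num.Theory.
Import numFieldNormedType.Exports.
Local Open Scope classical_set_scope.
Local Open Scope ring_scope.

(** * Inequalities for finite products *)

Lemma ler_norm_prodB (R : numDomainType) (I : Type) (r : seq I) (F G : I -> R) :
  (forall i, `|F i| <= 1) -> (forall i, `|G i| <= 1) ->
  `|\prod_(i <- r) F i - \prod_(i <- r) G i| <= \sum_(i <- r) `|F i - G i|.
Proof.
move=> F1 G1; elim: r => [|i r IH]; first by rewrite !big_nil subrr normr0.
rewrite !big_cons.
set p := \prod_(j <- r) F j; set q := \prod_(j <- r) G j.
(* In this splitting the differences are multiplied only by [F i] and [q], both of absolute value at
   most 1. *)
have -> : F i * p - G i * q = F i * (p - q) + (F i - G i) * q.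
  by rewrite mulrBr mulrBl addrA subrK.
have q1 : `|q| <= 1.
  by rewrite normr_prod prodr_ile1// => j _; rewrite normr_ge0 G1.
rewrite (le_trans (ler_normD _ _))// !normrM addrC lerD//; first by rewrite ler_piMr.
by rewrite (le_trans _ IH)// ler_piMl.
Qed.

Lemma normr_prod_le_exp (R : numDomainType) n (F : 'I_n -> R) (M : R) :
  (forall k, `|F k| <= M) -> `|\prod_(k < n) F k| <= M ^+ n.
Proof.
move=> FM; rewrite normr_prod -[n in M ^+ n]card_ord -prodr_const.
by apply: ler_prod => k _; rewrite normr_ge0 FM.
Qed.

(** * Bounded continuous functions on the half-line *)

Section bounded_continuous.
Context {R : realType}.
Implicit Types (u v : R -> R) (M x : R).

Lemma Cb_norm_ub u x : Cb u -> 0 <= x -> `|u x| <= Cb_norm u.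
Proof.
move=> -[_ [M [_ bM]]] x0; apply: ub_le_sup; last by exists x; rewrite //= in_itv/= x0.
(* Boundedness provides a bound only for constants strictly above [M], hence [M + 1]. *)
by exists (M + 1) => _ [y y0 <-]; apply: bM => //; rewrite ltrDl.
Qed.

Lemma Cb_norm_le u M : (forall x, 0 <= x -> `|u x| <= M) -> Cb_norm u <= M.
Proof.
move=> uM; apply: ge_sup; first by exists `|u 0|, 0; rewrite //= in_itv/= lexx.
by move=> _ [x + <-]; rewrite /= in_itv/= andbT; exact: uM.
Qed.

Lemma Cb_norm_ge0 u : Cb u -> 0 <= Cb_norm u.
Proof. by move=> /Cb_norm_ub /(_ (lexx 0)); exact: le_trans. Qed.

(** Used with [v] the image under [Gamma] or [L] of an extended function: continuity is proved on
    the whole line and then restricted. *)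
Lemma Cb_of_continuous u v M : continuous v ->
  (forall x, 0 <= x -> u x = v x) -> (forall x, 0 <= x -> `|u x| <= M) -> Cb u.
Proof.
move=> cv uv uM; split.
  apply: (@subspace_eq_continuous _ _ _ v); last exact: continuous_subspaceT.
  by move=> x; rewrite inE /= in_itv/= andbT => /uv.
exists M; split; first exact: num_real.
by move=> y My x /=; rewrite in_itv/= andbT => /uM /le_trans; apply; exact: ltW.
Qed.

(* Constant extension to the left of [0] gives a function continuous and bounded
   on the whole line, so that measurability and continuity of the integrands are
   global. *)
Lemma Cb_extension u : Cb u ->
  exists v, [/\ continuous v, forall x, 0 <= x -> v x = u x &
                forall x, `|v x| <= Cb_norm u].
Proof.
move=> Cu; exists (fun x => u (Num.max x 0)); split=> [x|x x0|x].
- have [/subspace_continuousP cu _] := Cu.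
  have m0 : Rplus R (Num.max x 0) by rewrite /= in_itv/= le_max lexx orbT.
  apply: (@cvg_comp _ _ _ (fun y : R => Num.max y 0) u _ _ _ _ (cu _ m0)) => A wA.
  have /(_ _ wA) : (fun y : R => Num.max y 0) @ x --> Num.max x 0.
    apply: (@continuous_max _ _ (fun y : R => y) (fun=> 0)); first exact: cvg_id.
    exact: cvg_cst.
  (* [u] is continuous only relative to [[0, +oo[]; the truncated point always lies there. *)
  apply: (@filterS _ (nbhs x) _) => y; apply.
  by rewrite /= in_itv/= le_max lexx orbT.
- by rewrite max_l.
- by apply: Cb_norm_ub => //; rewrite le_max lexx orbT.
Qed.

End bounded_continuous.

(** * Integrals of bounded functions over sets of finite measure *)

Section Rintegral_bounded.
Context {d} {T : measurableType d} {R : realType}.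
Variables (mu : {measure set T -> \bar R}) (D : set T) (M : R).
Hypotheses (mD : measurable D) (muD : (mu D < +oo)%E).

Lemma integrable_of_bounded (f : T -> R) : measurable_fun D f ->
  (forall t, D t -> `|f t| <= M) -> mu.-integrable D (EFin \o f).
Proof.
move=> mf fM; apply: measurable_bounded_integrable => //.
exists M; split; first exact: num_real.
by move=> y My t /fM /le_trans; apply; exact: ltW.
Qed.

Lemma normr_Rintegral_le_bound (f : T -> R) : measurable_fun D f ->
  (forall t, D t -> `|f t| <= M) ->
  `|\int[mu]_(t in D) f t| <= M * fine (mu D).
Proof.
move=> mf fM.
have intf := integrable_of_bounded mf fM.
rewrite (le_trans (le_normr_Rintegral mD intf))// -Rintegral_cst//.
apply: le_Rintegral => //; first exact: integrable_norm.
apply: measurable_bounded_integrable => //; exact: bounded_cst.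
Qed.

Lemma continuous_Rintegral (f : R -> T -> R) :
  (forall t, continuous (f ^~ t)) -> (forall x, measurable_fun D (f x)) ->
  (forall x t, D t -> `|f x t| <= M) ->
  continuous (fun x => \int[mu]_(t in D) f x t).
Proof.
move=> cf mf fM x.
(* Continuity at [x] is local, so any open interval around [x] serves; the constant [M] dominates
   and is integrable because [mu D] is finite. *)
apply: (@continuity_under_integral _ _ _ _ f D mD (x - 1) (x + 1) _ _ (cst M)).
- by move=> y _; apply: integrable_of_bounded => // t /fM.
- by apply: aeW => t _ y _; exact: cf.
- apply: measurable_bounded_integrable => //; exact: bounded_cst.
- by move=> y _; apply: aeW => t; exact: fM.
- by rewrite inE/= in_itv/= ltrDl ltrBlDr ltrDl ltr01.
Qed.

End Rintegral_bounded.

Lemma ge0_integral_sum_of_measures d (T : measurableType d) (R : realType)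
    (N : nat) (m : 'I_N -> {measure set T -> \bar R})
    (mu : {measure set T -> \bar R}) (D : set T) (f : T -> \bar R) :
  (forall X, measurable X -> mu X = \sum_(i < N) m i X)%E ->
  measurable D -> (forall t, D t -> 0 <= f t)%E -> measurable_fun D f ->
  (\int[mu]_(t in D) f t = \sum_(i < N) \int[m i]_(t in D) f t)%E.
Proof.
move=> muE mD f0 mf.
(* [msum] takes a family indexed by the naturals, so [m] is continued by the zero measure. *)
pose m' n : {measure set T -> \bar R} :=
  if insub n is Some i then m i else mzero.
have m'E (i : 'I_N) : m' i = m i by rewrite /m' valK.
rewrite (@eq_measure_integral _ _ _ _ (msum m' N))//; last first.
  by move=> X mX _; rewrite muE//; apply: eq_bigr => i _; rewrite m'E.
by rewrite ge0_integral_measure_sum//; apply: eq_bigr => i _; rewrite m'E.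
Qed.

Lemma measurable_comp_mul (R : realType) (u : R -> R) (x : R) : continuous u ->
  measurable_fun setT (fun t : R => u (t * x)).
Proof.
move=> cu; apply: continuous_measurable_fun => t.
exact: (continuous_comp (@mulrr_continuous _ x t) (cu _)).
Qed.

(** * Borel measurability on row vectors, and marginals of symmetric laws *)

Section borelRn.
Context {R : realType} {n : nat}.

(** Open intervals generate the Borel sets of the line, and their preimages are open, hence
    generators of the sigma-algebra of [borelRn]. *)
Lemma continuous_measurable_borelRn (f : 'rV[R]_n -> R) :
  continuous f -> measurable_fun setT (f : borelRn R n -> R).
Proof.
move=> /continuousP cf.
apply: (measurability _ (RGenOpens.measurableE R)) => _ [_ [a [b ->] <-]].
by rewrite setTI; apply: sub_sigma_algebra; apply: cf; exact: interval_open.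
Qed.

Lemma measurable_coord (k : 'I_n) :
  measurable_fun setT (fun a : borelRn R n => (a : 'rV[R]_n) ord0 k).
Proof. by apply: continuous_measurable_borelRn; exact: coord_continuous. Qed.

Lemma measurable_orthant : measurable (@orthant R n).
Proof.
rewrite (_ : @orthant R n = \bigcap_(k in [set: 'I_n])
    (fun a : borelRn R n => (a : 'rV[R]_n) ord0 k) @^-1` Rplus R); last first.
  apply/seteqP; split=> [a a0 k _|a a0 k]; first by rewrite /= in_itv/= a0.
  by have := a0 k I; rewrite /= in_itv/= andbT.
apply: fin_bigcap_measurable => // k _; rewrite -[X in measurable X]setTI.
exact: measurable_coord.
Qed.

Lemma continuous_prod_coord (u : R -> R) (x : R) : continuous u ->
  continuous (fun a : 'rV[R]_n => \prod_(k < n) u (a ord0 k * x)).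
Proof.
move=> cu; apply: continuous_big; first exact: mul_continuous.
move=> k _ a.
exact: (continuous_comp (continuous_comp (@coord_continuous R 1 n ord0 k a)
  (@mulrr_continuous _ x _)) (cu _)).
Qed.

Lemma measurable_prod_coord (u : R -> R) (x : R) : continuous u ->
  measurable_fun (@orthant R n) (fun a : borelRn R n =>
    \prod_(k < n) u ((a : 'rV[R]_n) ord0 k * x)).
Proof.
by move=> cu; apply: measurable_funTS; apply: continuous_measurable_borelRn;
  exact: continuous_prod_coord.
Qed.

End borelRn.

(** By symmetry the law of coordinate [k] is the first marginal. The relation is an inequality
    because the orthant is in general only a subset of the points whose coordinate [k] is
    nonnegative. *)
Lemma le_integral_first_marginal (R : realType) (n : nat)
    (mu : probability (borelRn R n.+1) R) (k : 'I_n.+1) (g : R -> R) :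
  symmetric_measure mu -> measurable_fun setT g -> (forall t, 0 <= g t) ->
  (\int[mu]_(a in @orthant R n.+1) (g ((a : 'rV[R]_n.+1) ord0 k))%:E
    <= \int[first_marginal mu]_(t in Rplus R) (g t)%:E)%E.
Proof.
move=> smu mg g0.
pose c j (a : borelRn R n.+1) := (a : 'rV[R]_n.+1) ord0 j.
have mc j : measurable_fun setT (c j) := measurable_coord j.
have mEg : measurable_fun setT (EFin \o g) by exact/measurable_EFinP.
have law_c X : measurable X -> mu (c k @^-1` X) = mu (c ord0 @^-1` X).
  move=> mX; have mcX : measurable (c ord0 @^-1` X).
    by rewrite -[Y in measurable Y]setTI; exact: mc.
  (* Transposing [0] and [k] moves coordinate [k] to the first place. *)
  rewrite -[RHS](smu (tperm ord0 k) _ mcX); congr (mu _).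
  by apply/seteqP; split=> a; rewrite /c /= mxE tpermL.
rewrite (@eq_measure_integral _ _ _ _ (pushforward mu (c k)))//; last first.
  by move=> X mX _; rewrite -[RHS]/(mu (c k @^-1` X)) law_c.
rewrite (ge0_integral_pushforward (mc k))//=; last 2 first.
- exact: measurable_funS mEg.
- by move=> t _; rewrite lee_fin.
apply: ge0_subset_integral => //.
- exact: measurable_orthant.
- by rewrite -[X in measurable X]setTI; exact: mc.
- by apply: measurable_funS (measurableT_comp mEg (mc k)).
- by move=> a _; rewrite lee_fin.
- by move=> a a0; rewrite /= in_itv/= a0.
Qed.

(** * Integration against [K] and estimates for [Gamma] *)

Section operators.
Context {R : realType} {N : nat}.
Variables (alpha : 'I_N -> {nonneg R}).
Variables (A : forall i : 'I_N, probability (borelRn R i.+1) R).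
Implicit Types (u v : R -> R) (i : 'I_N) (x : R).

Lemma integral_K (g : R -> R) : measurable_fun setT g -> (forall t, 0 <= g t) ->
  (\int[K alpha A]_(t in Rplus R) (g t)%:E = \sum_(i < N)
    (i.+1%:R * (alpha i)%:num)%:E *
      \int[first_marginal (A i)]_(t in Rplus R) (g t)%:E)%E.
Proof.
move=> mg g0.
have mEg : measurable_fun (Rplus R) (EFin \o g).
  by apply: measurable_funTS; exact/measurable_EFinP.
rewrite (ge0_integral_sum_of_measures (m := fun i =>
  mscale (i.+1%:R * (alpha i)%:num)%:nng (first_marginal (A i))))//=.
  by apply: eq_bigr => i _; rewrite ge0_integral_mscale// => t _;
    rewrite lee_fin.
by move=> t _; rewrite lee_fin.
Qed.

Lemma K_lt_pinfty : (K alpha A (Rplus R) < +oo)%E.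
Proof.
rewrite /K; apply: lte_sum_pinfty => i _; rewrite /mscale/=.
by rewrite lte_mul_pinfty ?lee_fin// (le_lt_trans (probability_le1 _ _)) ?ltry.
Qed.

(** Allows [u] to be replaced by its extension: over the orthant, with [x] nonnegative, only values
    at nonnegative points enter. [eq_L] serves the same purpose for [L]. *)
Lemma eq_Gamma_ i u v x : 0 <= x -> (forall y, 0 <= y -> v y = u y) ->
  Gamma_ A i u x = Gamma_ A i v x.
Proof.
move=> x0 vu; apply: eq_Rintegral => a /set_mem a0.
by apply: eq_bigr => k _; rewrite vu// mulr_ge0// a0.
Qed.

Lemma eq_L u v x : 0 <= x -> (forall y, 0 <= y -> v y = u y) ->
  L alpha A u x = L alpha A v x.
Proof.
move=> x0 vu; apply: eq_Rintegral => a /set_mem; rewrite /= in_itv/= andbT => a0.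
by rewrite vu// mulr_ge0.
Qed.

Lemma orthant_lt_pinfty i : (A i (@orthant R i.+1) < +oo)%E.
Proof.
rewrite (le_lt_trans (probability_le1 _ _)) ?ltry//.
exact: measurable_orthant.
Qed.

Lemma normr_Gamma__le i u x : Cb u -> 0 <= x ->
  `|Gamma_ A i u x| <= Cb_norm u ^+ i.+1.
Proof.
move=> Cu x0; have [v [cv vu vM]] := Cb_extension Cu.
rewrite (eq_Gamma_ _ x0 vu).
have vprod a : orthant a -> `|\prod_(k < i.+1) v ((a : 'rV[R]_i.+1) ord0 k * x)|
    <= Cb_norm u ^+ i.+1 by move=> _; apply: normr_prod_le_exp.
apply: (le_trans (normr_Rintegral_le_bound measurable_orthant (orthant_lt_pinfty i)
  (measurable_prod_coord x cv) vprod)).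
(* What remains is that the orthant has mass at most 1. *)
rewrite ler_piMr//; first by rewrite exprn_ge0// Cb_norm_ge0.
rewrite -lee_fin fineK; first by apply: probability_le1; exact: measurable_orthant.
by rewrite ge0_fin_numE// orthant_lt_pinfty.
Qed.

Lemma continuous_Gamma_ i u M : continuous u -> (forall x, `|u x| <= M) ->
  continuous (Gamma_ A i u).
Proof.
move=> cu uM.
apply: (@continuous_Rintegral _ _ _ (A i) (@orthant R i.+1) (M ^+ i.+1)
  measurable_orthant (orthant_lt_pinfty i) (fun x a => \prod_(k < i.+1) u ((a : 'rV[R]_i.+1) ord0 k * x))).
- move=> a; apply: continuous_big; first exact: mul_continuous.
  by move=> k _ x; exact: (continuous_comp (@mulrl_continuous _ _ x) (cu _)).
- by move=> x; exact: measurable_prod_coord.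
- by move=> x a _; exact: normr_prod_le_exp.
Qed.

(** Telescoping under the integral produces [i.+1] terms, each bounded by the same integral against
    the first marginal. The right-hand side is kept in the extended reals, where nonnegative
    integrals add without integrability conditions. *)
Lemma le_normr_Gamma_B i u v x : continuous u -> continuous v ->
  (forall y, `|u y| <= 1) -> (forall y, `|v y| <= 1) ->
  symmetric_measure (A i) ->
  (`|Gamma_ A i u x - Gamma_ A i v x|%:E <= i.+1%:R%:E *
    \int[first_marginal (A i)]_(t in Rplus R) `|u (t * x) - v (t * x)|%:E)%E.
Proof.
move=> cu cv u1 v1 sA.
pose g (t : R) : R := `|u (t * x) - v (t * x)|.
have mg : measurable_fun setT g.
  by apply: measurableT_comp => //; apply: measurable_funB;
    exact: measurable_comp_mul.
pose p (w : R -> R) (a : borelRn R i.+1) : R :=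
  \prod_(k < i.+1) w ((a : 'rV[R]_i.+1) ord0 k * x).
have intp w : continuous w -> (forall y, `|w y| <= 1) ->
    (A i).-integrable (@orthant R i.+1) (EFin \o p w).
  move=> cw w1; apply: (integrable_of_bounded measurable_orthant (orthant_lt_pinfty i)
    (M := 1 ^+ i.+1)); first exact: measurable_prod_coord.
  by move=> a _; exact: normr_prod_le_exp.
have mo := @measurable_orthant R i.+1.
have mgc (k : 'I_i.+1) : measurable_fun (@orthant R i.+1)
    (fun a : borelRn R i.+1 => (g ((a : 'rV[R]_i.+1) ord0 k))%:E).
  apply: measurable_funTS; apply/measurable_EFinP.
  by apply: (measurableT_comp mg); exact: measurable_coord.
have iB : (A i).-integrable (@orthant R i.+1) (EFin \o (fun a => p u a - p v a)).
  exact: (integrableB mo (intp u cu u1) (intp v cv v1)).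
rewrite -RintegralB//; [|exact: intp|exact: intp].
rewrite EFin_normr_Rintegral//.
apply: (le_trans (le_abse_integral _ mo _)); first exact: measurable_int iB.
apply: (@le_trans _ _ (\int[A i]_(a in @orthant R i.+1)
    (\sum_(k < i.+1) (g ((a : 'rV[R]_i.+1) ord0 k))%:E)%E)%E).
  apply: ge0_le_integral => //.
  - by apply: measurableT_comp => //; exact: measurable_int iB.
  - exact: emeasurable_sum.
  - move=> a _; rewrite /= sumEFin lee_fin.
    exact: ler_norm_prodB.
rewrite ge0_integral_sum//; last by move=> k a _; rewrite lee_fin normr_ge0.
have g0 t : 0 <= g t by exact: normr_ge0.
apply: (le_trans (lee_sum _ (fun k _ => le_integral_first_marginal k sA mg g0))).
by rewrite sumr_const card_ord mule_natl.
Qed.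

(** * The linear operator [L] *)

Lemma integrable_K_mul u x : Cb u -> 0 <= x ->
  (K alpha A).-integrable (Rplus R) (EFin \o (fun a => u (a * x))).
Proof.
move=> Cu x0; have [v [cv vu vM]] := Cb_extension Cu.
apply: (@eq_integrable _ _ _ _ _ _ (EFin \o (fun a => v (a * x)))) => //.
  move=> a; rewrite inE /= in_itv/= andbT => a0.
  by rewrite vu// mulr_ge0.
apply: (integrable_of_bounded (M := Cb_norm u) _ K_lt_pinfty) => //.
by apply: measurable_funTS; exact: measurable_comp_mul.
Qed.

(** The total mass of [K] on the half-line serves as the operator bound for [L]. *)
Lemma normr_L_le u x : Cb u -> 0 <= x ->
  `|L alpha A u x| <= fine (K alpha A (Rplus R)) * Cb_norm u.
Proof.
move=> Cu x0; rewrite mulrC; apply: normr_Rintegral_le_bound => //.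
- exact: K_lt_pinfty.
- by apply/measurable_EFinP; exact: measurable_int (integrable_K_mul Cu x0).
- move=> a; rewrite /= in_itv/= andbT => a0.
  by apply: Cb_norm_ub => //; exact: mulr_ge0.
Qed.

Lemma continuous_L u M : continuous u -> (forall x, `|u x| <= M) ->
  continuous (L alpha A u).
Proof.
move=> cu uM.
apply: (@continuous_Rintegral _ _ _ (K alpha A) (Rplus R) M _ K_lt_pinfty
  (fun x a => u (a * x))) => //.
- by move=> a x; exact: (continuous_comp (@mulrl_continuous _ a x) (cu _)).
- by move=> x; apply: measurable_funTS; exact: measurable_comp_mul.
Qed.

Lemma L_bounded_linear : Cb_bounded_linear (L alpha A).
Proof.
split.
- move=> u Cu; have [v [cv vu vM]] := Cb_extension Cu.
  apply: (Cb_of_continuous (v := L alpha A v)); first exact: continuous_L cv vM.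
    by move=> x x0; exact: eq_L.
  by move=> x; exact: normr_L_le.
- move=> c u v Cu Cv x x0; rewrite /L RintegralD//; last 2 first.
  + exact: (integrableZl _ c (integrable_K_mul Cu x0)).
  + exact: integrable_K_mul.
  by rewrite RintegralZl//; exact: integrable_K_mul.
- exists (fine (K alpha A (Rplus R))); first exact: fine_ge0.
  by move=> u Cu; apply: Cb_norm_le => x; exact: normr_L_le.
Qed.

Lemma Gamma_lipschitz u v x : continuous u -> continuous v ->
  (forall y, `|u y| <= 1) -> (forall y, `|v y| <= 1) ->
  (forall i, symmetric_measure (A i)) ->
  `|Gamma alpha A u x - Gamma alpha A v x|
    <= L alpha A (fun y => `|u y - v y|) x.
Proof.
move=> cu cv u1 v1 sA.
have mg : measurable_fun setT (fun t : R => `|u (t * x) - v (t * x)|).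
  by apply: measurableT_comp => //; apply: measurable_funB;
    exact: measurable_comp_mul.
(* The integral is finite, the integrand being at most 2 and [K] having finite mass, so the
   comparison can be made in the extended reals. *)
rewrite -lee_fin /L /Rintegral fineK; last first.
  apply: integrable_fin_num => //.
  apply: (integrable_of_bounded (M := 2) _ K_lt_pinfty) => //.
    exact: measurable_funTS.
  by move=> t _; rewrite normr_id (le_trans (ler_normB _ _))// lerD.
rewrite integral_K// /Gamma -sumrB (le_trans (y := (\sum_(i < N)
    (alpha i)%:num * `|Gamma_ A i u x - Gamma_ A i v x|)%:E))//.
  rewrite lee_fin (le_trans (ler_norm_sum _ _ _))//; apply: ler_sum => i _.
  by rewrite -mulrBr normrM ger0_norm.
rewrite -sumEFin; apply: lee_sum => i _.
(* The weight of [K] splits into [alpha i], coming from [Gamma], and [i.+1], coming from the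
   estimate for [Gamma_]. *)
rewrite [_ * (alpha i)%:num]mulrC !EFinM -muleA.
by apply: lee_wpmul2l; [rewrite lee_fin|exact: le_normr_Gamma_B].
Qed.

End operators.

Theorem theorem4p2 (R : realType) (N : nat) (alpha : 'I_N -> {nonneg R})
    (A : forall i : 'I_N, probability (borelRn R i.+1) R)
    (N_ge1 : (1 <= N)%N)
    (alpha_sum : \sum_(i < N) (alpha i)%:num = 1)
    (A_supp : forall i : 'I_N, compactly_supported_in_orthant (A i))
    (A_sym : forall i : 'I_N, symmetric_measure (A i)) :
  [/\ forall u : R -> R, Cb u -> Cb (Gamma alpha A u),
      forall u : R -> R, Cb_unit_ball u -> Cb_unit_ball (Gamma alpha A u),
      Cb_bounded_linear (L alpha A) &
      forall u1 u2 : R -> R, Cb_unit_ball u1 -> Cb_unit_ball u2 ->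
        forall x : R, 0 <= x ->
          `|Gamma alpha A u1 x - Gamma alpha A u2 x|
            <= L alpha A (fun y => `|u1 y - u2 y|) x].
Proof.
have CbG u : Cb u -> Cb (Gamma alpha A u).
  move=> Cu; have [v [cv vu vM]] := Cb_extension Cu.
  apply: (@Cb_of_continuous _ _ (Gamma alpha A v)
      (\sum_(i < N) (alpha i)%:num * Cb_norm u ^+ i.+1)).
  - apply: continuous_big; first exact: add_continuous.
    by move=> i _ x; apply: cvgM; [exact: cvg_cst|exact: continuous_Gamma_ cv vM x].
  - by move=> x x0; apply: eq_bigr => i _; rewrite (eq_Gamma_ _ _ x0 vu).
  - move=> x x0; rewrite (le_trans (ler_norm_sum _ _ _))//; apply: ler_sum => i _.
    by rewrite normrM ger0_norm// ler_wpM2l// normr_Gamma__le.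
split => //.
- move=> u [Cu u1]; split; first exact: CbG.
  apply: Cb_norm_le => x x0; rewrite (le_trans (ler_norm_sum _ _ _))//.
  (* Writing 1 as the sum of the weights reduces the bound to one term at a time, where a power of a
     norm at most 1 is at most 1. *)
  rewrite -alpha_sum; apply: ler_sum => i _.
  rewrite normrM ger0_norm// ler_piMr// (le_trans (normr_Gamma__le _ i Cu x0))//.
  by rewrite exprn_ile1// Cb_norm_ge0.
- exact: L_bounded_linear.
- move=> u1 u2 [Cu1 u1_1] [Cu2 u2_1] x x0.
  have [v1 [cv1 vu1 vM1]] := Cb_extension Cu1.
  have [v2 [cv2 vu2 vM2]] := Cb_extension Cu2.
  (* Both sides depend only on values on the half-line, so [u1] and [u2] give way to extensions that
     are bounded by 1 on the whole line, as [Gamma_lipschitz] requires. *)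
  have Gv u v : (forall y, 0 <= y -> v y = u y) ->
      Gamma alpha A u x = Gamma alpha A v x.
    by move=> vu; apply: eq_bigr => i _; rewrite (eq_Gamma_ _ _ x0 vu).
  rewrite (Gv _ _ vu1) (Gv _ _ vu2).
  rewrite (@eq_L _ _ _ _ _ (fun y => `|v1 y - v2 y|))//.
    by apply: Gamma_lipschitz => // y; [apply: le_trans u1_1|apply: le_trans u2_1].
  by move=> y y0; rewrite vu1// vu2.
Qed.
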